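(* Let $n\geq2$ and let $H$ be a skew-Bush type Hadamard matrix of order $n^2$. Let $A=(J-H)/2$, $k\in\{3,4\}$, and $a\in D_A(k)$. Then $\mathfrak H_A(n^2,k,a)$ is a $\operatorname{PBIBD}(n^2,k;\lambda_1,\lambda_2)$ on $\mathcal X_1$, where $$(\lambda_1,\lambda_2)=\begin{cases} \left(n^2-2,\ \frac{(3n-4)(n+2)}{4}\right) & \text{if }(k,a)=(3,0),\\[2pt] \left(0,\ \frac{n(n-2)}{4}\right) & \text{if }(k,a)=(3,1),\\[2pt] \left(\frac{n^4}{16},\ \frac{n^2(3n^2-10n+12)}{16}\right) & \text{if }(k,a)=(4,-1),\\[2pt] \left(\frac{(n-2)(n+2)(7n^2-12)}{16},\ \frac{(n-2)(5n^3+20n^2-12n-24)}{16}\right) & \text{if }(k,a)=(4,0). \end{cases}$$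
   Context: A (real) Hadamard matrix of order $m$ is an $m\times m$ $\{\pm1\}$-matrix $H$ with $HH^{\top}=mI$. A Hadamard matrix $H$ of order $n^2$ is skew-Bush type if, written in $n\times n$ blocks $H=(H_{ij})_{i,j=1}^n$, one has $H_{ii}=J_n$ for all $i$, and $H_{ij}J_n=J_nH_{ij}=O$ and $H_{ij}^{\top}=-H_{ji}$ for all distinct $i,j$. ($J$ denotes an all-ones matrix.) $\mathcal X_1=([n^2],\{R_0,R_1,R_2\})$ is the symmetric association scheme on $[n^2]=\{1,\dots,n^2\}$ with $R_0=\{(x,x)\}$, $R_1=\{(x,y): x\neq y,\ \lfloor (x-1)/n\rfloor=\lfloor (y-1)/n\rfloor\}$, $R_2=\{(x,y):\lfloor (x-1)/n\rfloor\neq\lfloor (y-1)/n\rfloor\}$. For a $v\times v$ matrix $A$ and $\alpha\subset[v]$, $A[\alpha]$ is the principal submatrix indexed by $\alpha$; $D_A(k)$ is the set of values $\det(A[\alpha])$ over all $k$-subsets $\alpha$ of $[v]$; $\mathfrak H_A(v,k,a)$ is the $k$-uniform hypergraph on $[v]$ whose hyperedges are the $k$-subsets $\alpha$ with $\det(A[\alpha])=a$. A $\operatorname{PBIBD}(v,k;\lambda_1,\lambda_2)$ on a scheme $([v],\{R_0,R_1,R_2\})$ is a $k$-uniform hypergraph on $[v]$ in which every vertex lies in the same positive number of hyperedges and, for $i\in\{1,2\}$ and each $(x,y)\in R_i$, the pair $\{x,y\}$ is contained in exactly $\lambda_i$ hyperedges. *)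

(* Defs.v *)
From mathcomp Require Import all_boot all_order all_algebra.

Set Implicit Arguments.
Unset Strict Implicit.
Unset Printing Implicit Defensive.

Import Order.TTheory GRing.Theory Num.Theory.
Local Open Scope ring_scope.

Definition is_hadamard (R : realFieldType) (m : nat) (H : 'M[R]_m) : Prop :=
  (forall i j, H i j = 1 \/ H i j = -1) /\ H *m H^T = m%:R%:M.

Lemma block_index_proof (n : nat) (i r : 'I_n) : (i * n + r < n ^ 2)%N.
Proof.
rewrite -mulnn; apply: (@leq_trans (i.+1 * n)).
  by rewrite mulSn addnC ltn_add2r.
by rewrite leq_mul2r ltn_ord orbT.
Qed.

(* All indices are 0-based: the i-th block of [n^2] is {i n, ..., i n + n - 1},
   that is, the set of x with x %/ n = i. *)
Definition block_index (n : nat) (i r : 'I_n) : 'I_(n ^ 2) :=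
  Ordinal (block_index_proof i r).

Definition block (R : Type) (n : nat) (H : 'M[R]_(n ^ 2)) (i j : 'I_n) :
    'M[R]_n :=
  mxsub (block_index i) (block_index j) H.

Definition is_skew_bush (R : realFieldType) (n : nat) (H : 'M[R]_(n ^ 2)) :
    Prop :=
  (forall i : 'I_n, block H i i = const_mx 1) /\
  (forall i j : 'I_n, i != j ->
     [/\ block H i j *m (const_mx 1 : 'M_n) = 0,
         (const_mx 1 : 'M_n) *m block H i j = 0
       & (block H i j)^T = - block H j i]).

(* enum_val lists the elements of alpha in increasing order. *)
Definition principal_submx (R : Type) (v : nat) (A : 'M[R]_v)
    (alpha : {set 'I_v}) : 'M[R]_#|alpha| :=
  \matrix_(i, j) A (enum_val i) (enum_val j).

Definition minor_values (R : realFieldType) (v : nat) (A : 'M[R]_v) (k : nat) :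
    seq R :=
  [seq \det (principal_submx A alpha)
    | alpha : {set 'I_v} in [set beta : {set 'I_v} | #|beta| == k]].

(* A hypergraph on T is given by its set of hyperedges. *)
Definition minor_hypergraph (R : realFieldType) (v : nat) (A : 'M[R]_v)
    (k : nat) (a : R) : {set {set 'I_v}} :=
  [set alpha : {set 'I_v} |
    (#|alpha| == k) && (\det (principal_submx A alpha) == a)].

(* Symmetric association schemes with two classes. The numerals 0, 1, 2 at type
   'I_3 are those of the ring Z/3, hence the ordinals 0, 1, 2. *)
Definition is_symmetric_scheme (T : finType) (S : 'I_3 -> rel T) : Prop :=
  [/\ forall x y, S 0 x y = (x == y),
      forall x y, exists! i, S i x y,
      forall i, exists x y, S i x y,
      forall i, symmetric (S i)
    & exists p : 'I_3 -> 'I_3 -> 'I_3 -> nat, forall h i j x y, S h x y ->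
        #|[set z | S i x z && S j z y]| = p h i j].

Definition is_pbibd (T : finType) (S : 'I_3 -> rel T) (E : {set {set T}})
    (k l1 l2 : nat) : Prop :=
  is_symmetric_scheme S /\
  [/\ forall e, e \in E -> #|e| = k,
      exists2 r : nat, (0 < r)%N & forall x, #|[set e in E | x \in e]| = r,
      forall x y, S 1 x y -> #|[set e in E | [set x; y] \subset e]| = l1
    & forall x y, S 2 x y -> #|[set e in E | [set x; y] \subset e]| = l2].

Definition scheme_X1 (n : nat) (i : 'I_3) : rel 'I_(n ^ 2) :=
  fun x y =>
    match val i with
    | 0%N => x == y
    | 1%N => (x != y) && (x %/ n == y %/ n)%N
    | _ => (x %/ n != y %/ n)%N
    end.

(* Main.v *)
(** The matrix [A] is the adjacency matrix of an orientation of the complete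
    multipartite graph on the blocks, so a principal minor of order 3 counts the
    directed triangles on its three vertices, and one of order 4 is minus the
    number of directed Hamiltonian cycles on its four vertices. Both counts are
    0 or 1, as two such cycles traverse some edge in opposite directions.
    The cycles through a pair [x, y] are therefore counted by entries of [A^2]
    and [A^3]. If [D] is the all-ones block diagonal matrix, then
    [H^T = 2D - H], [HD = DH = nD] and [HJ = JH = nJ], so [HH^T = n^2 I] becomes
    [H^2 = 2nD - n^2 I], and [A^2], [A^3] are combinations of [I], [J], [D], [A].
    The hyperedges with minor 0 are the complement, and the degree of a vertex
    follows from the pair counts by double counting. *)
Require Import Defs.
From mathcomp Require Import all_boot all_order all_fingroup all_algebra.
From mathcomp Require Import ring lra zify.

Set Implicit Arguments.
Unset Strict Implicit.
Unset Printing Implicit Defensive.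

Import Order.TTheory GRing.Theory Num.Theory.
Local Open Scope ring_scope.

(** * Principal minors of orders 3 and 4 *)

Lemma det_principal_submx (R : comPzRingType) (v k : nat) (A : 'M[R]_v)
    (alpha : {set 'I_v}) (s : k.-tuple 'I_v) :
  uniq s -> alpha =i s ->
  \det (principal_submx A alpha) = \det (mxsub (tnth s) (tnth s) A).
Proof.
move=> us alphaE.
have card_alpha : #|alpha| = k by rewrite (eq_card alphaE) (card_uniqP us) size_tuple.
case: k / card_alpha s us alphaE => s us alphaE.
have s_alpha i : tnth s i \in alpha by rewrite alphaE mem_tnth.
pose g i := enum_rank_in (s_alpha i) (tnth s i).
have gK i : enum_val (g i) = tnth s i by rewrite enum_rankK_in.
have g_inj : injective g.
  by move=> i j gij; apply: (tuple_uniqP _ us); rewrite -!gK gij.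
have -> : mxsub (tnth s) (tnth s) A =
    row_perm (perm g_inj) (col_perm (perm g_inj) (principal_submx A alpha)).
  by apply/matrixP=> i j; rewrite !mxE !permE !gK.
(* Rows and columns are rearranged by the same permutation, so its sign enters squared. *)
rewrite row_permE col_permE !det_mulmx !det_perm odd_permV.
by rewrite mulrCA -expr2 sqrr_sign mulr1.
Qed.

(** With a zero diagonal only derangements contribute, and those of three points are the two
    3-cycles, which are even. *)
Lemma det_mxsub3 (R : comNzRingType) (v : nat) (A : 'M[R]_v) (x y z : 'I_v) :
  let s := [tuple x; y; z] in
  A x x = 0 -> A y y = 0 -> A z z = 0 ->
  \det (mxsub (tnth s) (tnth s) A) = A x y * A y z * A z x + A x z * A z y * A y x.
Proof.
move=> s Ax Ay Az; rewrite (expand_det_row _ ord0) !big_ord_recl big_ord0 /cofactor.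
rewrite !(expand_det_row _ ord0) !big_ord_recl !big_ord0 /cofactor !det_mx11.
rewrite !mxE /tnth /= Ax Ay Az; ring.
Qed.

(** The derangements of four points are three double transpositions, killed by [A a b * A b a = 0],
    and six 4-cycles. The latter are odd, hence the minus sign. *)
Lemma det_mxsub4 (R : comNzRingType) (v : nat) (A : 'M[R]_v) (x y z t : 'I_v) :
  let s := [tuple x; y; z; t] in
  (forall a b, A a b * A b a = 0) -> (forall a, A a a = 0) ->
  - \det (mxsub (tnth s) (tnth s) A) =
    A x y * A y z * A z t * A t x + A x t * A t z * A z y * A y x +
    (A x z * A z y * A y t * A t x + A x t * A t y * A y z * A z x) +
    (A x y * A y t * A t z * A z x + A x z * A z t * A t y * A y x).
Proof.
move=> s A2 A1; rewrite (expand_det_row _ ord0) !big_ord_recl big_ord0 /cofactor.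
rewrite !(expand_det_row _ ord0) !big_ord_recl !big_ord0 /cofactor.
rewrite !(expand_det_row _ ord0) !big_ord_recl !big_ord0 /cofactor !det_mx11.
rewrite !mxE /tnth /= !A1.
ring: (A2 x y) (A2 x z) (A2 x t) (A2 y z) (A2 y t) (A2 z t).
Qed.

(** * Sums over the k-subsets containing a given set *)

Definition sum_over_kset (R : nmodType) (T : finType) (f : {set T} -> R) (k : nat)
    (B : {set T}) : R :=
  \sum_(e : {set T} | (#|e| == k) && (B \subset e)) f e.

(** Double counting of the pairs [(u, e)] with [u] in [e :\: B]: each [e] occurs [k - #|B|]
    times. *)
Lemma sum_over_kset_rec (R : nmodType) (T : finType) (f : {set T} -> R) k (B : {set T}) :
  sum_over_kset f k B *+ (k - #|B|) =
  \sum_(u | u \notin B) sum_over_kset f k (u |: B).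
Proof.
rewrite /sum_over_kset -sumrMnl.
rewrite (exchange_big_dep (fun e : {set T} => (#|e| == k) && (B \subset e))) /=.
  apply: eq_bigr => e /andP[/eqP <- sBe].
  have <- : #|e :\: B| = (#|e| - #|B|)%N by rewrite cardsD (setIidPr sBe).
  rewrite -sumr_const.
  by apply: eq_bigl => u; rewrite !inE eqxx subUset sub1set sBe andbT.
by move=> u e _; rewrite subUset => /and3P[-> _ ->].
Qed.

Lemma sum_over_kset_card (R : nmodType) (T : finType) (f : {set T} -> R) k (B : {set T}) :
  #|B| = k -> sum_over_kset f k B = f B.
Proof.
move=> <-; rewrite /sum_over_kset (big_pred1 B) // => e /=.
rewrite [RHS]eq_sym eqEcard andbC; case: (boolP (B \subset e)) => //= sBe.
by rewrite eqn_leq (subset_leq_card sBe) andbT.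
Qed.

Lemma card_over_kset (R : nzSemiRingType) (T : finType) (E : {set {set T}}) k
    (B : {set T}) :
  {in E, forall e : {set T}, #|e| = k} ->
  #|[set e in E | B \subset e]|%:R =
  sum_over_kset (fun e => (e \in E)%:R : R) k B.
Proof.
move=> Ek; rewrite /sum_over_kset -sum1_card natr_sum [LHS]big_mkcond [RHS]big_mkcond /=.
apply: eq_bigr => e _; rewrite inE; case: (boolP (e \in E)) => [eE|_] /=.
  by rewrite Ek // eqxx.
by rewrite if_same.
Qed.

(** As [F] vanishes at [x] and [y], the sum may run over all points, as in an entry of a matrix
    product. *)
Lemma sum_over_kset3E (R : pzSemiRingType) (T : finType) (f : {set T} -> R)
    (F : T -> R) x y : x != y ->
  (forall z, z != x -> z != y -> f [set z; x; y] = F z) ->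
  F x = 0 -> F y = 0 ->
  sum_over_kset f 3 [set x; y] = \sum_z F z.
Proof.
move=> xy fF Fx Fy; have c2 : #|[set x; y]| = 2%N by rewrite cards2 xy.
have := sum_over_kset_rec f 3 [set x; y]; rewrite c2 mulr1n => ->.
rewrite [RHS](bigID (mem [set x; y])) /= [X in X + _]big1 ?add0r; last first.
  by move=> z /set2P[] ->.
apply: eq_bigr => z; rewrite !inE negb_or => /andP[zx zy].
by rewrite sum_over_kset_card ?setUA ?fF // -setUA cardsU1 c2 !inE negb_or zx zy.
Qed.

(** The two further points can be added in either order, so each 4-subset is counted twice. *)
Lemma sum_over_kset4E (R : pzSemiRingType) (T : finType) (f : {set T} -> R)
    (F : T -> T -> R) x y : x != y ->
  (forall z t, uniq [:: x; y; z; t] -> f [set t; z; x; y] = F z t) ->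
  (forall z t, ~~ uniq [:: x; y; z; t] -> F z t = 0) ->
  sum_over_kset f 4 [set x; y] *+ 2 = \sum_z \sum_t F z t.
Proof.
move=> xy fF F0; have c2 : #|[set x; y]| = 2%N by rewrite cards2 xy.
have := sum_over_kset_rec f 4 [set x; y]; rewrite c2 => ->.
rewrite [RHS](bigID (mem [set x; y])) /= [X in X + _]big1 ?add0r; last first.
  move=> z zxy; apply: big1 => t _; apply: F0 => /=.
  by case/set2P: zxy => ->; rewrite !inE eqxx ?orbT ?andbF.
apply: eq_bigr => z; rewrite !inE => zxy.
have c3 : #|z |: [set x; y]| = 3%N by rewrite cardsU1 c2 !inE zxy.
have := sum_over_kset_rec f 4 (z |: [set x; y]); rewrite c3 mulr1n => ->.
rewrite [RHS](bigID (mem (z |: [set x; y]))) /= [X in X + _]big1 ?add0r; last first.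
  move=> t txy; apply: F0 => /=; move: txy; rewrite !inE.
  by case/or3P=> /eqP->; rewrite eqxx ?orbT ?andbF.
apply: eq_bigr => t; rewrite !inE => tzxy.
rewrite sum_over_kset_card; last by rewrite cardsU1 c3 !inE tzxy.
rewrite !setUA fF // /= !inE !negb_or xy.
move: zxy tzxy; rewrite !negb_or => /andP[zx zy] /and3P[tz tx ty].
by rewrite (eq_sym x z) zx (eq_sym x t) tx (eq_sym y z) zy (eq_sym y t) ty
  (eq_sym z t) tz.
Qed.

(** * Orientations, and their minors as counts of directed cycles *)

Definition is_orientation (R : nzRingType) (v : nat) (A : 'M[R]_v) : Prop :=
  (forall x y, A x y = 0 \/ A x y = 1) /\ (forall x y, A x y * A y x = 0).

Lemma orientation_idem (R : nzRingType) v (A : 'M[R]_v) :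
  is_orientation A -> forall x y, A x y * A x y = A x y.
Proof. by case=> A01 _ x y; case: (A01 x y) => ->; rewrite ?mul0r ?mul1r. Qed.

Lemma orientation_diag (R : nzRingType) v (A : 'M[R]_v) :
  is_orientation A -> forall x, A x x = 0.
Proof. by move=> A_or x; rewrite -(orientation_idem A_or) A_or.2. Qed.

Lemma card3P (T : finType) (e : {set T}) :
  #|e| = 3%N -> exists x y z, uniq [:: x; y; z] /\ e =i [:: x; y; z].
Proof.
move=> ce; have := enum_uniq e; have := mem_enum e; rewrite cardE in ce.
case: (enum e) ce => [|x [|y [|z []]]] //= _ me ue.
by exists x, y, z; split=> // t; rewrite -me.
Qed.

Lemma card4P (T : finType) (e : {set T}) :
  #|e| = 4%N -> exists x y z t, uniq [:: x; y; z; t] /\ e =i [:: x; y; z; t].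
Proof.
move=> ce; have := enum_uniq e; have := mem_enum e; rewrite cardE in ce.
case: (enum e) ce => [|x [|y [|z [|t []]]]] //= _ me ue.
by exists x, y, z, t; split=> // a; rewrite -me.
Qed.

(** This reduces the claim that a cycle count is 0 or 1 to a polynomial identity modulo the
    relations of an orientation. *)
Lemma idem01 (R : idomainType) (c : R) : c * c = c -> c = 0 \/ c = 1.
Proof.
move=> cc; have /eqP : c * (c - 1) = 0 by rewrite mulrBr mulr1 cc subrr.
by rewrite mulf_eq0 subr_eq0 => /orP[] /eqP; [left|right].
Qed.

Section Minors.
Variables (R : idomainType) (v : nat) (A : 'M[R]_v).
Hypothesis A_or : is_orientation A.

Definition cycles3 x y z := A x y * A y z * A z x + A x z * A z y * A y x.

(** The six directed Hamiltonian cycles on four vertices, each next to its reverse. *)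
Definition cycles4 x y z t :=
  A x y * A y z * A z t * A t x + A x t * A t z * A z y * A y x +
  (A x z * A z y * A y t * A t x + A x t * A t y * A y z * A z x) +
  (A x y * A y t * A t z * A z x + A x z * A z t * A t y * A y x).

Lemma minor3E x y z (e : {set 'I_v}) :
  uniq [:: x; y; z] -> e =i [:: x; y; z] ->
  \det (principal_submx A e) = cycles3 x y z.
Proof.
move=> u me; rewrite (@det_principal_submx _ _ _ _ _ [tuple x; y; z]) //.
by rewrite det_mxsub3 //; apply: orientation_diag.
Qed.

Lemma minor4E x y z t (e : {set 'I_v}) :
  uniq [:: x; y; z; t] -> e =i [:: x; y; z; t] ->
  - \det (principal_submx A e) = cycles4 x y z t.
Proof.
move=> u me; rewrite (@det_principal_submx _ _ _ _ _ [tuple x; y; z; t]) //.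
by rewrite det_mxsub4 //; [apply: A_or.2 | apply: orientation_diag].
Qed.

Lemma minor3_01 (e : {set 'I_v}) : #|e| = 3%N ->
  \det (principal_submx A e) = 0 \/ \det (principal_submx A e) = 1.
Proof.
case/card3P=> x [y [z [u me]]]; rewrite (minor3E u me); apply: idem01.
have I := orientation_idem A_or; have [_ Z] := A_or; rewrite /cycles3.
ring: (I x y) (I y z) (I z x) (I x z) (I z y) (I y x) (Z x y) (Z y z) (Z z x).
Qed.

Lemma minor4_01 (e : {set 'I_v}) : #|e| = 4%N ->
  - \det (principal_submx A e) = 0 \/ - \det (principal_submx A e) = 1.
Proof.
case/card4P=> x [y [z [t [u me]]]]; rewrite (minor4E u me); apply: idem01.
have I := orientation_idem A_or; have [_ Z] := A_or; rewrite /cycles4.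
ring: (Z x y) (Z y z) (Z z x) (Z x t) (Z y t) (Z z t) (I x y) (I y z)
  (I z x) (I x z) (I z y) (I y x) (I x t) (I t x) (I y t) (I t y) (I z t) (I t z).
Qed.
End Minors.

(** * Sums of minors over the subsets through a pair *)

Section MinorSums.
Variables (R : idomainType) (v : nat) (A : 'M[R]_v).
Hypothesis A_or : is_orientation A.

(** A directed triangle through [x] and [y] consists of an edge between them and a walk of length 2
    back. *)
Lemma sum_minors3 x y : x != y ->
  sum_over_kset (fun e => \det (principal_submx A e)) 3 [set x; y] =
  A x y * (A *m A) y x + A y x * (A *m A) x y.
Proof.
move=> xy; rewrite (@sum_over_kset3E _ _ _ (fun z => cycles3 A x y z)) //.
- rewrite !mxE !mulr_sumr -big_split /=; apply: eq_bigr => z _.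
  by rewrite /cycles3; ring.
- move=> z zx zy; apply: minor3E => //; last first.
    by move=> t; rewrite !inE; case: (t == x); case: (t == y); case: (t == z).
  by rewrite /= !inE negb_or xy eq_sym zx eq_sym zy.
- by rewrite /cycles3 !(orientation_diag A_or); ring.
- by rewrite /cycles3 !(orientation_diag A_or); ring.
Qed.

(** Opposite vertices of a 4-cycle are joined by two walks of length 2, adjacent ones by an edge and
    a walk of length 3 back. Both sides stay doubled because 2 may vanish in [R]. *)
Lemma sum_minors4 x y : x != y ->
  sum_over_kset (fun e => - \det (principal_submx A e)) 4 [set x; y] *+ 2 =
  ((A *m A) x y * (A *m A) y x + A x y * (A *m A *m A) y x +
     A y x * (A *m A *m A) x y) *+ 2.
Proof.
have Z := A_or.2; have diag := orientation_diag A_or.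
move=> xy; rewrite (@sum_over_kset4E _ _ _ (fun z t => cycles4 A x y z t)) //.
- have walk3 a b : (A *m A *m A) a b = \sum_z \sum_t A a z * A z t * A t b.
    rewrite mxE exchange_big; apply: eq_bigr => t _.
    by rewrite mxE mulr_suml.
  have walk22 : (A *m A) x y * (A *m A) y x =
      \sum_z \sum_t A x z * A z y * (A y t * A t x).
    by rewrite !mxE mulr_suml; apply: eq_bigr => z _; rewrite mulr_sumr.
  have cyc a b : \sum_z \sum_t A a b * A b z * A z t * A t a =
      A a b * (A *m A *m A) b a.
    rewrite walk3 mulr_sumr; apply: eq_bigr => z _; rewrite mulr_sumr.
    by apply: eq_bigr => t _; rewrite !mulrA.
  (* Of the six directed 4-cycles on {x, y, z, t}, two have x and y opposite and
     four have them adjacent; exchanging z and t pairs them up. *)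
  transitivity (\sum_z \sum_t (A x y * A y z * A z t * A t x
      + A y x * A x z * A z t * A t y + A x z * A z y * (A y t * A t x)) +
    \sum_z \sum_t (A x y * A y t * A t z * A z x + A y x * A x t * A t z * A z y
      + A x t * A t y * (A y z * A z x))).
    rewrite -big_split; apply: eq_bigr => z _; rewrite -big_split.
    by apply: eq_bigr => t _; rewrite /cycles4 /=; ring.
  rewrite [X in _ + X]exchange_big -mulr2n /=; congr (_ *+ 2).
  under eq_bigr do rewrite !big_split /=.
  by rewrite !big_split /= !cyc -walk22; ring.
- move=> z t u; apply: minor4E => // a; rewrite !inE.
  by case: (a == x); case: (a == y); case: (a == z); case: (a == t).
(* A closed walk of length 4 with a repeated vertex contains a loop or a step followed by its
   reverse, so each term is 0. *)
- move=> z t; rewrite /= !inE (negPf xy) /= andbT !negb_and !negbK.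
  by case/or3P=> [/orP[]|/orP[]|] /eqP<-; rewrite /cycles4 ?diag;
    ring: (Z x y) (Z x z) (Z x t) (Z y z) (Z y t) (Z z t).
Qed.
End MinorSums.

(** * Block coordinates and the algebra spanned by I, D and J *)

Lemma block_index_div n (i r : 'I_n) : (block_index i r %/ n = i)%N.
Proof.
have n_gt0 : (0 < n)%N by apply: leq_ltn_trans (ltn_ord i).
by rewrite /= divnMDl // divn_small ?addn0.
Qed.

Lemma block_index_mod n (i r : 'I_n) : (block_index i r %% n = r)%N.
Proof. by rewrite /= modnMDl modn_small. Qed.

Lemma block_index_surj n (x : 'I_(n ^ 2)) : exists i r : 'I_n, x = block_index i r.
Proof.
have n_gt0 : (0 < n)%N by case: n x => // -[].
have lt_q : (x %/ n < n)%N by rewrite ltn_divLR // mulnn.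
have lt_r : (x %% n < n)%N by rewrite ltn_mod.
by exists (Ordinal lt_q), (Ordinal lt_r); apply: val_inj; rewrite /= -divn_eq.
Qed.

Lemma big_block_index (R : nmodType) n (F : 'I_(n ^ 2) -> R) :
  \sum_x F x = \sum_(i < n) \sum_(r < n) F (block_index i r).
Proof.
rewrite pair_bigA (reindex (fun p : 'I_n * 'I_n => block_index p.1 p.2)) //=.
apply: onW_bij; apply: inj_card_bij; last first.
  by rewrite card_prod !card_ord mulnn.
move=> [i r] [j s] /= e; congr pair; apply: val_inj.
  by rewrite /= -(block_index_div i r) e block_index_div.
by rewrite /= -(block_index_mod i r) e block_index_mod.
Qed.

(** The Kronecker product of the identity and the all-ones matrix of order [n]. *)
Definition same_block_mx (R : pzSemiRingType) (n : nat) : 'M[R]_(n ^ 2) :=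
  \matrix_(x, y) (x %/ n == y %/ n)%N%:R.
Arguments same_block_mx {R n}.

Section BlockSpan.
Variables (R : comNzRingType) (n : nat).
Local Notation D := (same_block_mx : 'M[R]_(n ^ 2)).
Local Notation J := (const_mx 1 : 'M[R]_(n ^ 2)).

Lemma tr_same_block_mx : D^T = D.
Proof. by apply/matrixP=> x y; rewrite !mxE eq_sym. Qed.

Lemma mulmx_same_block (M : 'M[R]_(n ^ 2)) x (j s : 'I_n) :
  (M *m D) x (block_index j s) = \sum_r M x (block_index j r).
Proof.
rewrite mxE big_block_index (bigD1 j) //= [X in _ + X]big1 ?addr0.
  by apply: eq_bigr => r _; rewrite mxE !block_index_div eqxx mulr1.
move=> i /negPf ij; apply: big1 => r _.
by rewrite mxE !block_index_div (inj_eq val_inj) ij mulr0.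
Qed.

Lemma same_block_mx_sqr : D *m D = n%:R *: D.
Proof.
apply/matrixP=> x y; have [j [s ->]] := block_index_surj y.
rewrite mulmx_same_block !mxE; under eq_bigr do rewrite mxE !block_index_div.
by rewrite sumr_const card_ord block_index_div mulr_natl.
Qed.

Lemma const_mx_same_block : J *m D = n%:R *: J.
Proof.
apply/matrixP=> x y; have [j [s ->]] := block_index_surj y.
rewrite mulmx_same_block !mxE; under eq_bigr do rewrite mxE.
by rewrite sumr_const card_ord mulr1.
Qed.

Lemma same_block_const_mx : D *m J = n%:R *: J.
Proof.
apply: trmx_inj; rewrite trmx_mul tr_same_block_mx linearZ /= trmx_const.
exact: const_mx_same_block.
Qed.

Lemma const_mx_sqr : J *m J = (n ^ 2)%:R *: J.
Proof.
apply/matrixP=> x y; rewrite !mxE; under eq_bigr do rewrite !mxE mulr1.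
by rewrite sumr_const card_ord mulr1.
Qed.

(** The general element of the Bose-Mesner algebra of [scheme_X1]; its entry at [(x, y)] depends
    only on the relation between [x] and [y]. *)
Definition block_span (a b c : R) : 'M[R]_(n ^ 2) := a%:M + b *: D + c *: J.

Lemma block_spanE a b c x y :
  block_span a b c x y = a *+ (x == y) + b * (x %/ n == y %/ n)%N%:R + c.
Proof. by rewrite !mxE mulr1. Qed.

Lemma block_span_mul a b c a' b' c' :
  block_span a b c *m block_span a' b' c' =
  block_span (a * a') (a * b' + b * a' + b * b' * n%:R)
    (a * c' + c * a' + (b * c' + c * b') * n%:R + c * c' * (n ^ 2)%:R).
Proof.
rewrite /block_span !mulmxDl !mulmxDr !mul_scalar_mx !mul_mx_scalar.
rewrite -!scalemxAl -!scalemxAr same_block_mx_sqr const_mx_sqr.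
rewrite same_block_const_mx const_mx_same_block.
apply/matrixP=> x y; rewrite !mxE; case: (x == y); rewrite ?mulr1n ?mulr0n; ring.
Qed.
End BlockSpan.

(** * The association scheme, and designs obtained from pair counts *)

Lemma scheme_X1_symmetric n : (2 <= n)%N -> is_symmetric_scheme (@scheme_X1 n).
Proof.
move=> hn; have n_gt0 : (0 < n)%N by lia.
pose i0 := Ordinal n_gt0; pose i1 := Ordinal hn.
have rep i : exists x y, @scheme_X1 n i x y.
  case: i => -[|[|[|//]]] ? /=.
  - by exists (block_index i0 i0), (block_index i0 i0); rewrite /scheme_X1 /=.
  - exists (block_index i0 i0), (block_index i0 i1).
    by rewrite /scheme_X1 !block_index_div eqxx andbT -val_eqE.
  - exists (block_index i0 i0), (block_index i1 i0).
    by rewrite /scheme_X1 !block_index_div.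
split=> //.
- move=> x y; case: (eqVneq x y) => [->|xy].
    exists 0; split=> [|[[|[|[|//]]] ?]]; rewrite /scheme_X1 /= ?eqxx //.
    by move=> _; apply: val_inj.
  case: (boolP (x %/ n == y %/ n)%N) => b.
    exists 1; split=> [|[[|[|[|//]]] ?]]; rewrite /scheme_X1 /= ?(negPf xy) ?b //.
    by move=> _; apply: val_inj.
  exists 2; split=> [|[[|[|[|//]]] ?]]; rewrite /scheme_X1 /= ?(negPf xy) ?b ?(negPf b) //.
  by move=> _; apply: val_inj.
- by move=> [[|[|[|//]]] ?] x y; rewrite /scheme_X1 /= 1?eq_sym // ![(y %/ n == _)%N]eq_sym.
(* The adjacency matrices of the scheme are I, D - I and J - D. *)
pose c (i : 'I_3) : int * int * int :=
  match val i with 0%N => (1, 0, 0) | 1%N => (-1, 1, 0) | _ => (0, -1, 1) end.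
have indic i x y : (scheme_X1 i x y)%:R = block_span n (c i).1.1 (c i).1.2 (c i).2 x y.
  rewrite block_spanE; case: i => -[|[|[|//]]] ?; rewrite /scheme_X1 /c /=.
  - by case: eqP; rewrite ?mulr1n ?mulr0n ?mul0r.
  - case: eqVneq => [->|_]; rewrite /= ?eqxx; last case: eqP; by rewrite ?mulr1n ?mulr0n ?mul0r.
  - by case: eqP; rewrite ?mul0rn ?mulr1 ?mulr0.
(* Intersection numbers are entries of products of two adjacency matrices, and [block_span_mul]
   keeps these products in the span. *)
pose S i j x y := #|[set z | scheme_X1 i x z && @scheme_X1 n j z y]|.
have cardE i j x y : (S i j x y)%:R =
    (block_span n (c i).1.1 (c i).1.2 (c i).2 *m block_span n (c j).1.1 (c j).1.2 (c j).2) x y.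
  rewrite /S mxE -sum1_card natr_sum big_mkcond; apply: eq_bigr => z _ /=.
  by rewrite inE -!indic; do 2 case: scheme_X1.
have rep2 h : exists p : 'I_(n ^ 2) * 'I_(n ^ 2), scheme_X1 h p.1 p.2.
  by have [x [y xy]] := rep h; exists (x, y).
(* The numbers are read off at a chosen pair of each relation; any other pair in that relation gives
   the same entry. *)
exists (fun h i j => S i j (xchoose (rep2 h)).1 (xchoose (rep2 h)).2).
move=> h i j x y hxy; apply/eqP; rewrite -(eqr_nat int) !cardE block_span_mul.
have := xchooseP (rep2 h); move: (xchoose _) => [x' y'] /= hxy'.
rewrite !block_spanE; have [-> ->] : (x == y) = (x' == y') /\
    (x %/ n == y %/ n)%N = (x' %/ n == y' %/ n)%N.
  move: hxy hxy'; case: h => -[|[|[|//]]] ?; rewrite /scheme_X1 /=.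
  - by move=> /eqP-> /eqP->; rewrite !eqxx.
  - by move=> /andP[/negPf-> ->] /andP[/negPf-> ->].
  - case: (eqVneq x y) => [->|_]; first by rewrite eqxx.
    case: (eqVneq x' y') => [->|_]; first by rewrite eqxx.
    by move=> /negPf-> /negPf->.
by [].
Qed.

(** Counting the pairs [(u, e)] with [x] and [u] distinct points of [e] gives the degree times
    [k - 1] as [(n - 1) f1 + (n^2 - n) f2], which does not depend on [x]. The values [f1] and [f2]
    lie in [R]; the natural numbers are the counts at one sample pair of each relation. *)
Lemma pbibd_of_pair_counts (R : numDomainType) (n k : nat) (f1 f2 : R)
    (E : {set {set 'I_(n ^ 2)}}) :
  (2 <= n)%N -> (2 <= k)%N -> {in E, forall e : {set 'I_(n ^ 2)}, #|e| = k} ->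
  E != set0 ->
  (forall x y : 'I_(n ^ 2), x != y ->
     #|[set e in E | [set x; y] \subset e]|%:R =
     if (x %/ n == y %/ n)%N then f1 else f2) ->
  exists l1 l2 : nat,
    [/\ is_pbibd (@scheme_X1 n) E k l1 l2, l1%:R = f1 & l2%:R = f2].
Proof.
move=> hn hk Ek /set0Pn[e0 e0E] pairs.
have X1 := scheme_X1_symmetric hn.
have n_gt0 : (0 < n)%N by lia.
pose i0 := Ordinal n_gt0; pose i1 := Ordinal hn.
pose x00 := block_index i0 i0; pose x01 := block_index i0 i1.
pose x10 := block_index i1 i0.
have := pairs x00 x01 isT; rewrite !block_index_div eqxx => N1.
have x010 : x00 != x10.
  by apply: contraTneq isT => /(congr1 (fun x => val x %/ n)%N); rewrite !block_index_div.
have := pairs x00 x10 x010; rewrite !block_index_div /= => N2.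
eexists; eexists; split; [|exact: N1|exact: N2].
have deg (x : 'I_(n ^ 2)) : #|[set e in E | x \in e]|%:R *+ k.-1 =
    (n ^ 2)%:R * f2 + (f1 - f2) * n%:R - f1.
  have -> : [set e in E | x \in e] = [set e in E | [set x] \subset e].
    by apply/setP=> e; rewrite !inE sub1set.
  rewrite (card_over_kset _ _ Ek).
  have := sum_over_kset_rec (fun e => (e \in E)%:R : R) k [set x].
  rewrite cards1 subn1 => ->.
  transitivity (\sum_(u | u != x) (f2 + (f1 - f2) * same_block_mx u x)).
    apply: eq_big => [u|u]; rewrite inE // => ux.
    rewrite -card_over_kset // pairs // mxE.
    by case: eqP; rewrite ?mulr1 ?mulr0 ?addr0 // addrC subrK.
  (* At [u = x] the summand takes the value [f1], so adding [f1] to both sides extends the sum to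
     all points. *)
  have gx : f2 + (f1 - f2) * same_block_mx x x = f1.
    by rewrite mxE eqxx mulr1 addrC subrK.
  apply: (addrI f1); rewrite -{1}gx -[LHS](bigD1 x (P := predT)) //= big_split /=.
  rewrite sumr_const card_ord -mulr_sumr.
  have -> : \sum_u (same_block_mx u x : R) = n%:R.
    have := congr1 (fun M : 'M_(n ^ 2) => M x x) (const_mx_same_block R n).
    by rewrite !mxE mulr1 => <-; apply: eq_bigr => u _; rewrite !mxE mul1r.
  by rewrite mulr_natl [RHS]addrC subrK.
split=> //; split=> //.
(* A point of the hyperedge [e0] has positive degree, and all degrees agree since [k.-1] can be
   cancelled. *)
- have [x xe] : exists x, x \in e0.
    by apply/set0Pn; rewrite -card_gt0 Ek //; lia.
  exists #|[set e in E | x \in e]|.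
    by rewrite card_gt0; apply/set0Pn; exists e0; rewrite inE e0E.
  move=> y; apply/eqP; rewrite -(eqr_nat R) -(@eqr_pMn2r _ k.-1) ?deg //; lia.
- move=> x y /andP[xy b]; apply/eqP; rewrite -(eqr_nat R) N1 pairs //.
  by rewrite b.
- move=> x y b; apply/eqP; rewrite -(eqr_nat R) N2 pairs ?(negPf b) //.
  by apply: contraNneq b => ->.
Qed.

(** * Skew-Bush type matrices: powers of A and pair sums *)

Section SkewBush.
Variables (R : realFieldType) (n : nat) (H : 'M[R]_(n ^ 2)).
Hypotheses (hn : (2 <= n)%N) (hH : is_hadamard H) (hB : is_skew_bush H).
Local Notation D := (same_block_mx : 'M[R]_(n ^ 2)).
Local Notation J := (const_mx 1 : 'M[R]_(n ^ 2)).

Let n_neq0 : n%:R != 0 :> R.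
Proof. by rewrite pnatr_eq0; lia. Qed.

Lemma skew_bush_tr : H^T = 2 *: D - H.
Proof.
have [HJ Hsk] := hB; apply/matrixP=> x y.
have [i [r ->]] := block_index_surj x; have [j [s ->]] := block_index_surj y.
rewrite !mxE !block_index_div (inj_eq val_inj); case: (eqVneq i j) => [->|ij].
  have E t u : H (block_index j t) (block_index j u) = 1.
    by have := congr1 (fun M : 'M_n => M t u) (HJ j); rewrite !mxE.
  by rewrite !E mulr1n; ring.
have [_ _ E] := Hsk i j ij; have := congr1 (fun M : 'M_n => M s r) E.
by rewrite !mxE mulr0 sub0r => ->; rewrite opprK.
Qed.

(** Right multiplication by [D] forms the row sums of the blocks: [n] on the diagonal, 0
    elsewhere. *)
Lemma skew_bush_same_block : H *m D = n%:R *: D.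
Proof.
have [HJ Hsk] := hB; apply/matrixP=> x y.
have [i [r ->]] := block_index_surj x; have [j [s ->]] := block_index_surj y.
rewrite mulmx_same_block !mxE !block_index_div (inj_eq val_inj).
transitivity (\sum_t block H i j r t); first by apply: eq_bigr => t _; rewrite mxE.
case: (eqVneq i j) => [->|ij].
  by rewrite HJ; under eq_bigr do rewrite mxE; rewrite sumr_const card_ord mulr1.
have [E _ _] := Hsk i j ij; have := congr1 (fun M : 'M_n => M r s) E.
by rewrite !mxE mulr0 => E0; rewrite -[RHS]E0; apply: eq_bigr => t _; rewrite !mxE mulr1.
Qed.

Lemma same_block_skew_bush : D *m H = n%:R *: D.
Proof.
apply: trmx_inj; rewrite trmx_mul skew_bush_tr linearZ /= tr_same_block_mx.
rewrite mulmxBl -scalemxAl same_block_mx_sqr skew_bush_same_block.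
by apply/matrixP=> x y; rewrite !mxE; ring.
Qed.

(** Multiplying [D *m H = n%:R *: D] by [J] on the left gives this identity up to the nonzero factor
    [n]. *)
Lemma const_mx_skew_bush : J *m H = n%:R *: J.
Proof.
apply: (scalerI n_neq0); rewrite scalemxAl -const_mx_same_block -mulmxA.
by rewrite same_block_skew_bush -scalemxAr const_mx_same_block.
Qed.

Lemma skew_bush_const_mx : H *m J = n%:R *: J.
Proof.
apply: (scalerI n_neq0); rewrite scalemxAr -same_block_const_mx mulmxA.
by rewrite skew_bush_same_block -scalemxAl same_block_const_mx.
Qed.

Lemma skew_bush_sqr : H *m H = (2 * n%:R) *: D - (n%:R ^+ 2)%:M.
Proof.
have [_] := hH; rewrite skew_bush_tr mulmxBr -scalemxAr skew_bush_same_block natrX.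
by move=> <-; rewrite scalerA opprB addrC subrK.
Qed.

Variable A : 'M[R]_(n ^ 2).
Hypothesis hA : A = 2^-1 *: (J - H).

Lemma skew_bush_orientation_pair x y : A x y + A y x = 1 - D x y.
Proof.
have := congr1 (fun M : 'M_(n ^ 2) => M x y) skew_bush_tr.
by rewrite hA !mxE => ->; field.
Qed.

Lemma skew_bush_orientation : is_orientation A.
Proof.
have A01 x y : A x y = 0 \/ A x y = 1.
  rewrite hA !mxE; case: (hH.1 x y) => ->; [left|right]; lra.
split=> // x y; have := skew_bush_orientation_pair x y; rewrite mxE.
case: (A01 x y) (A01 y x) => -> [] ->; case: (_ == _);
  rewrite ?mulr1n ?mulr0n ?mulr0 ?mul0r //; lra.
Qed.

Lemma skew_bush_orientation_sqr :
  A *m A = 4^-1 *: ((n%:R ^+ 2 - 2 * n%:R) *: J + (2 * n%:R) *: D - (n%:R ^+ 2)%:M).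
Proof.
rewrite hA -scalemxAl -scalemxAr scalerA mulmxBl !mulmxBr.
rewrite const_mx_sqr const_mx_skew_bush skew_bush_const_mx skew_bush_sqr natrX.
by apply/matrixP=> x y; rewrite !mxE; case: (x == y); rewrite ?mulr1n ?mulr0n; field.
Qed.

(** Multiply the formula for [A *m A] by [A], using JA = (n^2 - n)/2 J and DA = n/2 (J - D). *)
Lemma skew_bush_orientation_cube :
  A *m A *m A = 4^-1 *:
    (((n%:R ^+ 2 - 2 * n%:R) * (n%:R ^+ 2 - n%:R) / 2 + n%:R ^+ 2) *: J
     - n%:R ^+ 2 *: D - n%:R ^+ 2 *: A).
Proof.
rewrite skew_bush_orientation_sqr -scalemxAl mulmxBl mulmxDl mul_scalar_mx -!scalemxAl.
congr (_ *: _); rewrite hA -!scalemxAr !mulmxBr const_mx_sqr const_mx_skew_bush same_block_skew_bush.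
rewrite same_block_const_mx natrX.
by apply/matrixP=> x y; rewrite !mxE; field.
Qed.

(** Inside a block there is no edge. Across blocks there is exactly one, and n(n - 2)/4 walks of
    length 2 close it up. *)
Lemma sum_minors3_skew_bush x y : x != y ->
  sum_over_kset (fun e => \det (principal_submx A e)) 3 [set x; y] =
  if (x %/ n == y %/ n)%N then 0 else n%:R * (n%:R - 2) / 4.
Proof.
move=> xy; have A_or := skew_bush_orientation.
have Axy := skew_bush_orientation_pair x y.
rewrite (sum_minors3 A_or xy) skew_bush_orientation_sqr !mxE [y == x]eq_sym (negPf xy).
rewrite [(y %/ n == _)%N]eq_sym; move: Axy; rewrite mxE.
case: eqP => _; rewrite ?mulr1n ?mulr0n => Axy.
  have [-> ->] : A x y = 0 /\ A y x = 0.
    by case: (A_or.1 x y) (A_or.1 y x) => Ex [] Ey; split; lra.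
  by rewrite !mul0r addr0.
have -> : A y x = 1 - A x y by lra.
by field.
Qed.

(** Inside a block only the product of the two entries of [A *m A], each n^2/4, survives. Across
    blocks the single edge, say from [x] to [y], adds the walks of length 3 from [y] to [x]; as
    [A y x = 0], the [A] term of the cube drops out. *)
Lemma sum_minors4_skew_bush x y : x != y ->
  sum_over_kset (fun e => - \det (principal_submx A e)) 4 [set x; y] =
  if (x %/ n == y %/ n)%N then n%:R ^+ 4 / 16
  else n%:R ^+ 2 * (3 * n%:R ^+ 2 - 10 * n%:R + 12) / 16.
Proof.
move=> xy; have A_or := skew_bush_orientation.
have Zxy := A_or.2 x y; have Axy := skew_bush_orientation_pair x y.
apply: (@pmulrnI _ 2) => //.
rewrite (sum_minors4 A_or xy) skew_bush_orientation_cube skew_bush_orientation_sqr; congr (_ *+ 2).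
move: Axy; rewrite !mxE [y == x]eq_sym (negPf xy).
rewrite [(y %/ n == _)%N]eq_sym; case: eqP => _; rewrite ?mulr1n ?mulr0n => Axy.
  have [-> ->] : A x y = 0 /\ A y x = 0.
    by case: (A_or.1 x y) (A_or.1 y x) => Ex [] Ey; split; lra.
  by field.
have Ayx : A y x = 1 - A x y by lra.
rewrite Ayx in Zxy *.
have I : A x y * A x y = A x y by apply: orientation_idem.
by field: I.
Qed.
End SkewBush.

(** * The number of k-subsets through a pair *)

Lemma sum_over_kset_one (R : comNzRingType) (T : finType) k (B : {set T}) :
  (#|B| <= k)%N ->
  sum_over_kset (fun=> 1 : R) k B *+ (k - #|B|)`! = ((#|T| - #|B|) ^_ (k - #|B|))%:R.
Proof.
move=> leBk; have [m] := ubnP (k - #|B|)%N.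
elim: m B leBk => // m IH B leBk; rewrite ltnS => km.
case Ed : (k - #|B|)%N km => [|d] km.
  by rewrite sum_over_kset_card ?fact0 ?ffactn0 ?mulr1n //; lia.
(* Adding the missing points one at a time counts ordered choices, whence the factorial and the
   falling factorial. *)
rewrite factS mulrnA; have := sum_over_kset_rec (fun=> 1 : R) k B; rewrite Ed => ->.
rewrite -sumrMnl.
rewrite (eq_bigr (fun=> ((#|T| - #|B|).-1 ^_ d)%:R)) => [|u uB].
  rewrite sumr_const; have -> : #|[pred u | u \notin B]| = (#|T| - #|B|)%N.
    by rewrite -(cardC B) addKn; apply: eq_card.
  by rewrite ffactnS natrM mulr_natl.
have c : #|u |: B| = #|B|.+1 by rewrite cardsU1 uB.
have := IH (u |: B); rewrite c.
have -> : (k - #|B|.+1 = d)%N by lia.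
rewrite -subnS; apply; lia.
Qed.

Lemma sum_over_kset_one3 (R : comNzRingType) (n : nat) (x y : 'I_(n ^ 2)) :
  (2 <= n)%N -> x != y ->
  sum_over_kset (fun=> 1 : R) 3 [set x; y] = n%:R ^+ 2 - 2.
Proof.
move=> hn xy; have := @sum_over_kset_one R _ 3 [set x; y].
rewrite cards2 xy card_ord (_ : (3 - _)`! = 1)%N // mulr1n ffactn1 => -> //.
by rewrite natrB ?natrX //; nia.
Qed.

Lemma sum_over_kset_one4 (R : comNzRingType) (n : nat) (x y : 'I_(n ^ 2)) :
  (2 <= n)%N -> x != y ->
  sum_over_kset (fun=> 1 : R) 4 [set x; y] *+ 2 = (n%:R ^+ 2 - 2) * (n%:R ^+ 2 - 3).
Proof.
move=> hn xy; have := @sum_over_kset_one R _ 4 [set x; y].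
rewrite cards2 xy card_ord (_ : (4 - _)`! = 2)%N // => -> //.
rewrite ffactnS ffactn1 -subnS natrM !natrB ?natrX //; nia.
Qed.

(** * The four cases *)

Theorem corollary3p7 (R : realFieldType) (n : nat) (hn : (2 <= n)%N)
    (H : 'M[R]_(n ^ 2)) (hH : is_hadamard H) (hB : is_skew_bush H)
    (A : 'M[R]_(n ^ 2)) (hA : A = 2^-1 *: (const_mx 1 - H))
    (k : nat) (hk : k \in [:: 3; 4]%N)
    (a : R) (ha : a \in minor_values A k) :
  exists l1 l2 : nat,
    is_pbibd (@scheme_X1 n) (minor_hypergraph A k a) k l1 l2 /\
    [\/ [/\ k = 3%N, a = 0,
            l1%:R = n%:R ^+ 2 - 2 :> R
          & l2%:R = (3 * n%:R - 4) * (n%:R + 2) / 4 :> R],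
        [/\ k = 3%N, a = 1,
            l1%:R = 0 :> R
          & l2%:R = n%:R * (n%:R - 2) / 4 :> R],
        [/\ k = 4%N, a = -1,
            l1%:R = n%:R ^+ 4 / 16 :> R
          & l2%:R = n%:R ^+ 2 * (3 * n%:R ^+ 2 - 10 * n%:R + 12) / 16 :> R]
      | [/\ k = 4%N, a = 0,
            l1%:R = (n%:R - 2) * (n%:R + 2) * (7 * n%:R ^+ 2 - 12) / 16 :> R
          & l2%:R = (n%:R - 2) *
              (5 * n%:R ^+ 3 + 20 * n%:R ^+ 2 - 12 * n%:R - 24) / 16 :> R]].
Proof.
have A_or := skew_bush_orientation hH hB hA.
have Ek : {in minor_hypergraph A k a, forall e : {set 'I_(n ^ 2)}, #|e| = k}.
  by move=> e; rewrite inE => /andP[/eqP].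
have [e0 e0k a_det] : exists2 e0 : {set 'I_(n ^ 2)},
    #|e0| = k & a = \det (principal_submx A e0).
  by have /imageP[e0] := ha; rewrite inE => /eqP; exists e0.
have E0 : minor_hypergraph A k a != set0.
  by apply/set0Pn; exists e0; rewrite inE a_det eqxx andbT; apply/eqP.
have k_ge2 : (2 <= k)%N by move: hk; rewrite !inE => /orP[] /eqP->.
have design f1 f2 := @pbibd_of_pair_counts R n k f1 f2 _ hn k_ge2 Ek E0.
(* Any [g] that agrees with the indicator of minor [a] on k-subsets computes the pair counts. For
   nonzero [a] it is the minor up to sign, for [a = 0] it is 1 minus that. *)
have count (g : {set 'I_(n ^ 2)} -> R) x y :
    (forall e : {set _}, #|e| = k -> (\det (principal_submx A e) == a)%:R = g e) ->
    #|[set e in minor_hypergraph A k a | [set x; y] \subset e]|%:R =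
    sum_over_kset g k [set x; y].
  move=> gE; rewrite (card_over_kset _ _ Ek); apply: eq_bigr => e /andP[/eqP ek _].
  by rewrite inE -gE //; have -> : #|e| == k by apply/eqP.
(* Since [a] is an attained minor, these two facts leave only the four listed cases. *)
have a3 : k = 3%N -> a = 1 \/ a = 0.
  by rewrite -e0k a_det => /(minor3_01 A_or)[->|->]; [right|left].
have a4 : k = 4%N -> a = -1 \/ a = 0.
  rewrite -e0k a_det -[\det _]opprK => /(minor4_01 A_or)[->|->].
    by right; rewrite oppr0.
  by left.
clear e0 e0k a_det; move: hk; rewrite !inE => /orP[] /eqP kE; subst k.
  case: (a3 erefl) => ?; subst a.
    have [x y xy|l1 [l2 [des E1 E2]]] := design 0 (n%:R * (n%:R - 2) / 4).
      rewrite -(sum_minors3_skew_bush hn hH hB hA xy); apply: count => e ek.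
      by case: (minor3_01 A_or ek) => ->; rewrite ?eqxx // eq_sym oner_eq0.
    by exists l1, l2; split=> //; apply: Or42.
  have [x y xy|l1 [l2 [des E1 E2]]] :=
      design (n%:R ^+ 2 - 2) ((3 * n%:R - 4) * (n%:R + 2) / 4).
    transitivity (sum_over_kset (fun=> 1) 3 [set x; y] -
        sum_over_kset (fun e => \det (principal_submx A e)) 3 [set x; y]).
      rewrite /sum_over_kset -sumrB; apply: count => e ek.
      by case: (minor3_01 A_or ek) => ->; rewrite ?oner_eq0 ?eqxx ?subr0 ?subrr.
    rewrite (sum_minors3_skew_bush hn hH hB hA xy) sum_over_kset_one3 //.
    by case: ifP => _; field.
  by exists l1, l2; split=> //; apply: Or41.
case: (a4 erefl) => ?; subst a.
  have [x y xy|l1 [l2 [des E1 E2]]] := design (n%:R ^+ 4 / 16)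
      (n%:R ^+ 2 * (3 * n%:R ^+ 2 - 10 * n%:R + 12) / 16).
    rewrite -(sum_minors4_skew_bush hn hH hB hA xy); apply: count => e ek.
    by rewrite -eqr_opp opprK; case: (minor4_01 A_or ek) => ->;
      rewrite ?eqxx // eq_sym oner_eq0.
  by exists l1, l2; split=> //; apply: Or43.
have [x y xy|l1 [l2 [des E1 E2]]] :=
    design ((n%:R - 2) * (n%:R + 2) * (7 * n%:R ^+ 2 - 12) / 16)
           ((n%:R - 2) * (5 * n%:R ^+ 3 + 20 * n%:R ^+ 2 - 12 * n%:R - 24) / 16).
  transitivity (sum_over_kset (fun=> 1) 4 [set x; y] -
      sum_over_kset (fun e => - \det (principal_submx A e)) 4 [set x; y]).
    rewrite /sum_over_kset -sumrB; apply: count => e ek.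
    by rewrite -oppr_eq0; case: (minor4_01 A_or ek) => ->;
      rewrite ?oner_eq0 ?eqxx ?subr0 ?subrr.
  (* The number of all 4-subsets through a pair is available in doubled form only. *)
  apply: (@pmulrnI _ 2) => //; rewrite mulrnBl sum_over_kset_one4 //.
  rewrite (sum_minors4_skew_bush hn hH hB hA xy).
  by case: ifP => _; field.
by exists l1, l2; split=> //; apply: Or44.
Qed.
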